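(* Let $d\geq 2$, $k\geq 2d$ with $\gcd(k,d)=1$, and $a_n:=\cos\big(\lfloor nk/d\rfloor\frac{2\pi}{k}\big)$ for $0\le n\le d-1$. Let $L_0(y):=\prod_{s=1}^{d-1}\frac{y-a_s}{1-a_s}$. Then \[ \vartheta(\overline{K_{k/d}})=\frac{k}{\pi}\int_{-1}^{1}L_0(y)\frac{dy}{\sqrt{1-y^2}} =\frac{(-1)^{d-1}k}{\prod_{n=1}^{d-1}(1-a_n)}\sum_{j=0}^{\lfloor (d-1)/2\rfloor}\frac{1}{2^{2j}}\binom{2j}{j}\sigma_{d-1-2j}(a_1,\dots,a_{d-1}), \] where $\sigma_0,\dots,\sigma_{d-1}$ are the elementary symmetric polynomials in $d-1$ variables.
   Context: For integers $k\geq 2d\geq 2$, $K_{k/d}$ has vertex set $\{0,\dots,k-1\}$, with $i,j$ adjacent iff $d\leq|i-j|\leq k-d$; $\overline{K_{k/d}}$ is its complement. The Lov\'asz theta number of $G=(V,E)$ is $\vartheta(G)=\max\{\sum_{x,y}B(x,y): B\in\mathbb{R}^{V\times V}$ symmetric positive semidefinite, $\sum_x B(x,x)=1$, $B(x,y)=0$ for $xy\in E\}$. *)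

(* Defs.v *)
From mathcomp Require Import all_boot all_order all_algebra.
From mathcomp Require Import all_classical all_reals all_analysis.
From mathcomp Require Import lra.
(* Not imported: its notations clash with those of MathComp-Analysis. *)
From mathcomp Require mpoly.
Set Implicit Arguments.
Unset Strict Implicit.
Unset Printing Implicit Defensive.
Import Order.TTheory GRing.Theory Num.Theory.
Import numFieldNormedType.Exports.
Local Open Scope classical_set_scope.
Local Open Scope ring_scope.

(* The adjacency relation of K_{k/d}; `|i - j|%N is the distance on nat. *)
Definition circular_clique (k d : nat) : rel 'I_k :=
  fun i j => (d <= `|i - j| <= k - d)%N.
Arguments circular_clique : clear implicits.

Definition complement_graph (n : nat) (e : rel 'I_n) : rel 'I_n :=
  fun i j => (i != j) && ~~ e i j.

Definition psdmx (R : realType) (n : nat) (B : 'M[R]_n) : Prop :=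
  B^T = B /\ forall v : 'cV[R]_n, 0 <= (v^T *m B *m v) 0 0.

Definition theta_feasible (R : realType) (n : nat) (e : rel 'I_n)
    : set 'M[R]_n :=
  [set B | [/\ psdmx B, \tr B = 1 & forall x y, e x y -> B x y = 0]].

Definition theta_values (R : realType) (n : nat) (e : rel 'I_n) : set R :=
  [set \sum_x \sum_y B x y | B in theta_feasible e].

(* By lovasz_theta_max below, this supremum is a maximum whenever the vertex *)
(* set is nonempty and e is irreflexive.                                     *)
Definition lovasz_theta (R : realType) (n : nat) (e : rel 'I_n) : R :=
  sup (theta_values e).

Lemma psd_diag_ge0 (R : realType) (n : nat) (B : 'M[R]_n) x :
  psdmx B -> 0 <= B x x.
Proof.
case=> _ /(_ (delta_mx x 0)).
by rewrite trmx_delta -rowE -colE !mxE.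
Qed.

Lemma psd_entry_le (R : realType) (n : nat) (B : 'M[R]_n) x y :
  psdmx B -> `|B x y| *+ 2 <= B x x + B y y.
Proof.
move=> [Bsym Bpsd].
have quad (a : R) :
    0 <= B x x + a * B x y + a * B y x + a ^+ 2 * B y y.
  have := Bpsd (delta_mx x 0 + a *: delta_mx y 0).
  rewrite [(_ + _)^T]linearD/= [(_ *: _)^T]linearZ/= !trmx_delta.
  rewrite mulmxDl mulmxDr mulmxDl.
  rewrite -!scalemxAr -!scalemxAl -!rowE -!colE !mxE.
  by move=> h; apply: (le_trans h); rewrite expr2; lra.
have Byx : B y x = B x y by rewrite -[in LHS]Bsym mxE.
have := quad 1; have := quad (-1); rewrite Byx.
by case: (ger0P (B x y)) => _; lra.
Qed.

Lemma theta_feasible_entry_le1 (R : realType) (n : nat) (e : rel 'I_n)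
    (B : 'M[R]_n) x y :
  theta_feasible e B -> `|B x y| <= 1.
Proof.
move=> [Bpsd Btr _].
have diag_le1 z : B z z <= 1.
  rewrite -Btr /mxtrace (bigD1 z)//= lerDl.
  by apply: sumr_ge0 => i _; exact: psd_diag_ge0.
have := psd_entry_le x y Bpsd; have := diag_le1 x; have := diag_le1 y; lra.
Qed.

Lemma theta_feasible_compact (R : realType) (n : nat) (e : rel 'I_n) :
  compact [set v : 'rV[R]_(n * n) | theta_feasible e (vec_mx v)].
Proof.
have cont_entry x y : continuous (fun v : 'rV[R]_(n * n) => vec_mx v x y).
  rewrite (_ : (fun _ => _) = fun v : 'rV[R]_(n * n) =>
      v ord0 (mxvec_index x y)).
    exact: coord_continuous.
  by apply/funext => v; rewrite mxE.
apply: (@subclosed_compact _ _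
    [set v : 'rV[R]_(n * n) | forall i, `[(-1 : R), 1]%classic (v ord0 i)]).
- rewrite (_ : [set _ | _] =
    [set v | forall x y, (vec_mx v)^T x y - vec_mx v x y = 0] `&`
    [set v | forall u : 'cV[R]_n, 0 <= (u^T *m vec_mx v *m u) 0 0] `&`
    [set v | \tr (vec_mx v) = 1 :> R] `&`
    [set v | forall x y, e x y -> vec_mx v x y = 0 :> R]); last first.
    apply/seteqP; split=> v /=.
      by case=> -[h1 h2] h3 h4; split=> //; split=> //; split=> // x y;
        rewrite h1 subrr.
    case=> -[[h1 h2] h3] h4; split=> //; split=> //.
    by apply/matrixP => x y; apply/eqP; rewrite -subr_eq0 h1.
  apply: closedI; first apply: closedI; first apply: closedI.
  + rewrite (_ : mkset _ = \bigcap_(p : 'I_n * 'I_n)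
      ((fun v : 'rV[R]_(n * n) => vec_mx v p.2 p.1 - vec_mx v p.1 p.2)
        @^-1` [set t | t = 0])); last first.
      apply/seteqP; split=> v /= h; first by move=> p _; have := h p.1 p.2; rewrite [_^T _ _]mxE.
      by move=> x y; rewrite [_^T _ _]mxE; exact: (h (x, y) I).
    apply: closed_bigI => p _.
    apply: (continuous_closedP _).1; last exact: closed_eq.
    move=> v; apply: (@cvgB _ _ _ (nbhs v) _ _ (fun w => vec_mx w p.1 p.2)).
      exact: (cont_entry p.2 p.1 v).
    exact: (cont_entry p.1 p.2 v).
  + rewrite (_ : mkset _ = \bigcap_(u : 'cV[R]_n)
      ((fun v : 'rV[R]_(n * n) => (u^T *m vec_mx v *m u) 0 0)
        @^-1` [set t | 0 <= t])); last first.
      apply/seteqP; split=> v /= h u; last by have := h u I.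
      by move=> _; exact: (h u).
    apply: closed_bigI => u _.
    apply: (continuous_closedP _).1; last exact: closed_ge.
    rewrite (_ : (fun _ => _) = fun v : 'rV[R]_(n * n) =>
      \sum_y (\sum_x u x 0 * vec_mx v x y) * u y 0); last first.
      apply/funext => v; rewrite mxE; apply: eq_bigr => y _; rewrite mxE.
      by congr (_ * _); apply: eq_bigr => x _; rewrite [_^T _ _]mxE.
    apply: continuous_big => [|y _]; first exact: add_continuous.
    move=> v; apply: (@cvgM _ _ (nbhs v) _ _ (fun=> u y 0)).
      apply: (continuous_big (op := +%R)) => [|x _].
        exact: add_continuous.
      move=> w; apply: (@cvgM _ _ (nbhs w) _ (fun=> u x 0)).
        exact: cvg_cst.
      exact: (cont_entry x y w).
    exact: cvg_cst.
  + apply: (@preimage_closed _ _ (fun v : 'rV[R]_(n * n) => \tr (vec_mx v))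
      [set t | t = 1]); last exact: closed_eq.
    move=> v _; apply: continuous_big => [|x _]; first exact: add_continuous.
    exact: cont_entry.
  + rewrite (_ : mkset _ = \bigcap_(p in [set p : 'I_n * 'I_n | e p.1 p.2])
      ((fun v : 'rV[R]_(n * n) => vec_mx v p.1 p.2)
        @^-1` [set t | t = 0])); last first.
      apply/seteqP; split=> v /= h; first by move=> p /= /h.
      by move=> x y exy; exact: (h (x, y)).
    apply: closed_bigI => p _.
    by apply: (continuous_closedP _).1; [exact: cont_entry | exact: closed_eq].
- apply: (@rV_compact R _ (fun=> `[(-1 : R), 1]%classic)) => _.
  exact: segment_compact.
- move=> v /= fv i; have [x y] := mxvec_indexP i.
  have := theta_feasible_entry_le1 x y fv.
  by rewrite mxE ler_norml in_itv.
Qed.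

Lemma lovasz_theta_max (R : realType) (n : nat) (e : rel 'I_n) :
  (0 < n)%N -> irreflexive e ->
  theta_values e (lovasz_theta R e) /\
  (forall t, theta_values e t -> t <= lovasz_theta R e).
Proof.
move=> n0 eirr.
pose f (v : 'rV[R]_(n * n)) : R := \sum_x \sum_y vec_mx v x y.
have cf : continuous f.
  apply: continuous_big => [|x _]; first exact: add_continuous.
  apply: continuous_big => [|y _]; first exact: add_continuous.
  rewrite (_ : (fun _ => _) = fun v : 'rV[R]_(n * n) =>
    v ord0 (mxvec_index x y)); first exact: coord_continuous.
  by apply/funext => v; rewrite mxE.
have nR0 : n%:R != 0 :> R by rewrite pnatr_eq0 -lt0n.
have ne0 : [set v : 'rV[R]_(n * n) | theta_feasible e (vec_mx v)] !=set0.
  exists (mxvec (n%:R^-1)%:M) => /=; rewrite mxvecK; split.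
  - split; first exact: tr_scalar_mx.
    move=> v; rewrite mul_mx_scalar -scalemxAl mxE mulr_ge0// mxE.
    by apply: sumr_ge0 => i _; rewrite mxE -expr2 sqr_ge0.
  - by rewrite mxtrace_scalar -[LHS]mulr_natr mulVf.
  - move=> x y exy; rewrite mxE; case: eqP => // xy.
    by move: exy; rewrite xy eirr.
have [v /set_mem/= fv vmax] :=
  EVT_max_rV ne0 (@theta_feasible_compact R n e) (continuous_subspaceT cf).
have ub t : theta_values e t -> t <= f v.
  move=> [B fB <-]; have := vmax (mxvec B); rewrite /f mxvecK; apply.
  by apply/mem_set; rewrite /= mxvecK.
have fvin : theta_values e (f v) by exists (vec_mx v).
have -> : lovasz_theta R e = f v.
  apply/eqP; rewrite eq_le; apply/andP; split.
    by apply: ge_sup => //; exists (f v).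
  by apply: ub_le_sup => //; exists (f v).
by [].
Qed.

Definition elem_sym (R : realType) (m j : nat) (x : 'I_m -> R) : R :=
  mpoly.meval x (mpoly.mesym m R j).

Lemma elem_symE (R : realType) (m j : nat) (x : 'I_m -> R) :
  elem_sym j x = \sum_(h : {set 'I_m} | #|h| == j) \prod_(i in h) x i.
Proof.
rewrite /elem_sym /mpoly.mesym.
rewrite (big_morph _ (mpoly.mevalD x) (mpoly.meval0 x)).
apply: eq_bigr => h _.
rewrite (big_morph _ (mpoly.mevalM x) (mpoly.meval1 x)).
by apply: eq_bigr => i _; exact: mpoly.mevalXU.
Qed.

Definition circ_cos (R : realType) (k d n : nat) : R :=
  cos ((n * k %/ d)%:R * (2 * pi / k%:R)).

Definition circ_L0 (R : realType) (k d : nat) (y : R) : R :=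
  \prod_(1 <= s < d) ((y - circ_cos R k d s) / (1 - circ_cos R k d s)).

(* Main.v *)
Require Import Defs.
From mathcomp Require Import all_boot all_order all_algebra.
From mathcomp Require Import all_classical all_reals all_analysis.
From mathcomp Require Import measurable_realfun ring lra zify.
Set Implicit Arguments.
Unset Strict Implicit.
Unset Printing Implicit Defensive.
Import Order.TTheory GRing.Theory Num.Theory.
Import numFieldNormedType.Exports.
Local Open Scope classical_set_scope.
Local Open Scope ring_scope.

(* Let d' be the inverse of d modulo k.  Since floor(nk/d) = -d' (nk mod d)
   modulo k, the roots of L0 are the numbers cos(2 pi d' r / k), 1 <= r < d.
   With q = exp(2 i pi d' / k), the coefficients of
   (1 - z) \prod_(1 <= r < d) (1 - q^r z) (1 - q^-r z) satisfy a two-term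
   recurrence whose ratios are nonnegative over the first half because d' r is
   neither 0 nor 1 modulo k for 0 < r < d.  Summing them shows that
   L0(cos t) = \sum_(r < d) c_r cos(r t) with all c_r >= 0, so that
   B(x, y) = L0(cos(2 pi d' (x - y) / k)) / k is feasible, of value k c_0.
   Conversely the roots floor(nk/d) and floor((d - n)k/d) come in pairs of
   neighbours m, m + 1 (up to sign), hence L0(cos(2 pi j / k)) >= 0 for all j,
   and averaging any feasible B against these weights bounds its value by k c_0.
   Finally c_0 is the mean of L0(cos t) over [0, pi], which is the integral, and
   is also computed from the moments of cos. *)

(** * A cosine expansion with nonnegative coefficients *)

Lemma sin_addn_pi (R : realType) (x : R) n :
  sin (x + n%:R * pi) = (-1) ^+ n * sin x.
Proof.
elim: n => [|n IH]; first by rewrite mul0r addr0 mul1r.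
by rewrite -natr1 mulrDl mul1r addrA sinDpi IH exprS mulN1r mulNr.
Qed.

Lemma cos_addn_2pi (R : realType) (x : R) n :
  cos (x + n%:R * (2 * pi)) = cos x.
Proof.
elim: n => [|n IH]; first by rewrite mul0r addr0.
rewrite -natr1 mulrDl mul1r addrA [2 * pi in X in _ + X]mulrC mulr_natr.
by rewrite cosD2pi IH.
Qed.

Lemma cos_mul_cos (R : realType) (x y : R) :
  2 * cos x * cos y = cos (x + y) + cos (x - y).
Proof. by rewrite cosD cosB; ring. Qed.

Lemma cos_mul_sin (R : realType) (x y : R) :
  2 * cos x * sin y = sin (x + y) - sin (x - y).
Proof. by rewrite sinD sinB; ring. Qed.

Lemma cos_sub_cos (R : realType) (x y : R) :
  cos (2 * x) - cos (2 * y) = - 2 * sin (x + y) * sin (x - y).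
Proof.
have -> : 2 * x = (x + y) + (x - y) by ring.
have -> : 2 * y = (x + y) - (x - y) by ring.
by rewrite (cosD (x + y)) (cosB (x + y)); ring.
Qed.

(* The coefficient of z^j in the Laurent polynomial
   \prod_(r < n) (z - 2 c_r + z^-1). *)
Fixpoint laurent_coef (R : realType) (c : nat -> R) (n : nat) (j : int) : R :=
  if n is m.+1 then
    laurent_coef c m (j - 1) - 2 * c m * laurent_coef c m j
    + laurent_coef c m (j + 1)
  else (j == 0)%:R.

Lemma laurent_coefN (R : realType) (c : nat -> R) n j :
  laurent_coef c n (- j) = laurent_coef c n j.
Proof.
elim: n j => [|n IH] j /=; first by rewrite oppr_eq0.
have -> : - j - 1 = - (j + 1) by ring.
have -> : - j + 1 = - (j - 1) by ring.
by rewrite !IH; ring.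
Qed.

Lemma laurent_coef_small (R : realType) (c : nat -> R) n (j : int) :
  (n%:Z < j)%R -> laurent_coef c n j = 0.
Proof.
elim: n j => [|n IH] j /= hj; first by case: eqP => // h; lia.
by rewrite !IH; [ring | lia..].
Qed.

Lemma laurent_coef_lead (R : realType) (c : nat -> R) n :
  laurent_coef c n n = 1.
Proof.
elim: n => [|n IH] //=; rewrite (@laurent_coef_small _ _ _ (n.+1)); last lia.
rewrite (@laurent_coef_small _ _ _ (n.+1%:Z + 1)); last lia.
by have -> : n.+1%:Z - 1 = n by [lia]; rewrite IH; ring.
Qed.

(** The Laurent polynomial with even coefficients [g], cut off at degree [N], at z = e^(it), with
    opposite powers folded together. *)
Definition cos_sum (R : realType) (g : int -> R) (N : nat) (t : R) : R :=
  g 0 + 2 * \sum_(0 <= j < N) g j.+1%:Z * cos (j.+1%:R * t).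

(** Product-to-sum turns [2 * cos t] into index shifts by one either way; evenness folds index -1
    onto 1, and the last term corrects for the cut at [N]. *)
Lemma mul_cos_sum (R : realType) (g : int -> R) N t :
  (forall j, g (- j) = g j) ->
  2 * cos t * cos_sum g N t =
    cos_sum (fun j => g (j - 1) + g (j + 1)) N t
    + 2 * (g N * cos (N.+1%:R * t) - g N.+1 * cos (N%:R * t)).
Proof.
move=> geven; elim: N => [|N IH].
  rewrite /cos_sum !big_geq// mul1r mul0r cos0 sub0r geven add0r.
  by ring.
have sumS g' : cos_sum g' N.+1 t =
    cos_sum g' N t + 2 * (g' N.+1%:Z * cos (N.+1%:R * t)).
  by rewrite /cos_sum big_nat_recr//=; ring.
rewrite !sumS mulrDr {}IH.
have -> : N.+1%:Z - 1 = N by lia.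
have -> : N.+1%:Z + 1 = N.+2 by lia.
have := cos_mul_cos t (N.+1%:R * t).
have -> : t + N.+1%:R * t = N.+2%:R * t by rewrite -(natr1 N.+1); ring.
have -> : t - N.+1%:R * t = - (N%:R * t) by rewrite -(natr1 N); ring.
rewrite cosN => h.
have -> : 2 * cos t * (2 * (g N.+1 * cos (N.+1%:R * t))) =
   2 * g N.+1 * (2 * cos t * cos (N.+1%:R * t)) by ring.
by rewrite h; ring.
Qed.

Lemma cos_sumBZ (R : realType) (g1 g2 : int -> R) a N t :
  cos_sum (fun j => g1 j - a * g2 j) N t =
  cos_sum g1 N t - a * cos_sum g2 N t.
Proof.
rewrite /cos_sum.
under eq_bigr do rewrite mulrBl -mulrA.
by rewrite sumrB -mulr_sumr; ring.
Qed.

(** At z = e^(it) each factor z - 2c + z^-1 is 2(cos t - c), and [n <= N] makes the cut harmless. *)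
Lemma cos_sum_laurent (R : realType) (c : nat -> R) n N t : (n <= N)%N ->
  cos_sum (laurent_coef c n) N t = \prod_(0 <= r < n) (2 * (cos t - c r)).
Proof.
elim: n N => [|n IH] N nN.
  rewrite big_geq// /cos_sum big1 ?mulr0 ?addr0// => j _.
  by rewrite mul0r.
rewrite big_nat_recr//= -(IH N (ltnW nN)) [RHS]mulrC.
have -> : 2 * (cos t - c n) * cos_sum (laurent_coef c n) N t =
   2 * cos t * cos_sum (laurent_coef c n) N t
   - 2 * c n * cos_sum (laurent_coef c n) N t by ring.
rewrite mul_cos_sum; last exact: laurent_coefN.
rewrite !(@laurent_coef_small _ _ n) ?mul0r; [|lia..].
rewrite subrr mulr0 addr0 -cos_sumBZ /cos_sum.
by congr (_ + _ * _) => /=; [|apply: eq_bigr => j _]; rewrite addrAC.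
Qed.

(** Half of q^(r+1) + q^-(r+1) with q = e^(2ib): the shift makes the indices below n run through the
    exponents 1 to n. *)
Definition qcos (R : realType) (b : R) (r : nat) : R :=
  cos (r.+1%:R * (2 * b)).

(* With q = e^(2ib), the differences are the coefficients of
   (1 - z) \prod_(1 <= r <= n) (1 - q^r z) (1 - q^-r z), a q-binomial product;
   hence the two-term recurrence. *)
Lemma laurent_diff_rec (R : realType) (b : R) n (j : int) :
  let h i := laurent_coef (qcos b) n i - laurent_coef (qcos b) n (i - 1) in
  h j * sin ((j + n)%:~R * b) + h (j - 1) * sin ((n.+2%:Z - j)%:~R * b) = 0.
Proof.
elim: n j => [|n IH] j.
  rewrite /=; have [->|j0] := eqVneq j 0.
    by rewrite /= addr0 mul0r sin0; ring.
  have [->|j1] := eqVneq j 1.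
    have -> : (1 + 0)%R = 1 :> int by [].
    by have -> : 2%:Z - 1 = 1 by [lia]; rewrite subrr /=; ring.
  have -> : (j - 1 == 0) = false by apply/negbTE; lia.
  have [->|j2] := eqVneq j 2.
    by rewrite (subrr (2 : int)) mulr0z mul0r sin0; ring.
  have -> : (j - 1 - 1 == 0) = false by apply/negbTE; lia.
  by ring.
move: (IH (j - 1)) (IH j) (IH (j + 1)) => /=.
set g := laurent_coef (qcos b) n.
rewrite [j - 1 + 1]subrK [j - 1 - 1 + 1]subrK [j + 1 - 1]addrK.
(* [M] = (2n+2)b is the angle of the new factor; [A] = (2n+3)b is the one with which the recurrences
   at j - 1, j, j + 1 combine. *)
pose x : R := j%:~R * b; pose y : R := n%:R * b.
pose M : R := 2 * y + 2 * b; pose A : R := 2 * y + 3 * b.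
have -> : qcos b n = cos M by congr cos; rewrite /M /y -natr1; ring.
have -> : (j - 1 + n)%:~R * b = y + x - b.
  by rewrite rmorphD rmorphB /x /y /=; ring.
have -> : (n.+2%:Z - (j - 1))%:~R * b = y + 3 * b - x.
  by rewrite !rmorphB /x /y /= -?pmulrn -!natr1; ring.
have -> : (j + n)%:~R * b = y + x by rewrite rmorphD /x /y /=; ring.
have -> : (n.+2%:Z - j)%:~R * b = y + 2 * b - x.
  by rewrite !rmorphB /x /y /= -?pmulrn -!natr1; ring.
have -> : (j + 1 + n)%:~R * b = y + x + b.
  by rewrite !rmorphD /x /y /=; ring.
have -> : (n.+2%:Z - (j + 1))%:~R * b = y + b - x.
  by rewrite !rmorphB rmorphD /x /y /= -?pmulrn -!natr1; ring.
have -> : (j + n.+1)%:~R * b = y + x + b.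
  by rewrite !rmorphD /x /y /= -?pmulrn -natr1; ring.
have -> : (n.+3%:Z - j)%:~R * b = y + 3 * b - x.
  by rewrite !rmorphB /x /y /= -?pmulrn -!natr1; ring.
have := cos_mul_sin M (y + x + b); have := cos_mul_sin M (y + 3 * b - x).
have := cos_mul_sin A (y + x); have := cos_mul_sin A (y + 2 * b - x).
have -> : M + (y + x + b) = A + (y + x) by rewrite /M /A; ring.
have -> : M - (y + x + b) = y + b - x by rewrite /M; ring.
have -> : M + (y + 3 * b - x) = A + (y + 2 * b - x) by rewrite /M /A; ring.
have -> : M - (y + 3 * b - x) = y + x - b by rewrite /M; ring.
have -> : A - (y + 2 * b - x) = y + x + b by rewrite /A; ring.
have -> : A - (y + x) = y + 3 * b - x by rewrite /A; ring.
move=> k4 k3 k2 k1 h1 h2 h3.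
(* The recurrences at j + 1 and j - 1 are added and 2 cos A times the one at j is subtracted; the
   leftover multiples of h(j) and h(j - 1) vanish by product-to-sum. *)
set lhs := (X in X = 0).
have -> : lhs =
  ((g (j + 1) - g j) * sin (y + x + b) + (g j - g (j - 1)) * sin (y + b - x))
  + ((g (j - 1) - g (j - 1 - 1)) * sin (y + x - b)
     + (g (j - 1 - 1) - g (j - 1 - 1 - 1)) * sin (y + 3 * b - x))
  - 2 * cos A * ((g j - g (j - 1)) * sin (y + x)
     + (g (j - 1) - g (j - 1 - 1)) * sin (y + 2 * b - x))
  + (g j - g (j - 1)) * (2 * cos A * sin (y + x)
     - 2 * cos M * sin (y + x + b) + sin (y + 3 * b - x) - sin (y + b - x))
  + (g (j - 1) - g (j - 1 - 1)) * (2 * cos A * sin (y + 2 * b - x)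
     - 2 * cos M * sin (y + 3 * b - x) + sin (y + x + b) - sin (y + x - b)).
  by rewrite /lhs; ring.
by rewrite h1 h2 h3 k1 k2 k3 k4; ring.
Qed.

(** * Inverses modulo k and signs of sines *)

Lemma coprime_invn (d k : nat) : (0 < d)%N -> coprime k d ->
  exists d' c, (d * d' = c * k + 1)%N.
Proof.
move=> d0; rewrite coprime_sym => /eqP g.
by case: (egcdnP k d0) => d' c + _; rewrite g mulnC => ?; exists d', c.
Qed.

Lemma pi_div_mul (R : realType) (k : nat) : (0 < k)%N ->
  k%:R * (pi / k%:R) = pi :> R.
Proof. by move=> k0; rewrite mulrC divfK// pnatr_eq0 -lt0n. Qed.

Lemma cos_2pi_opp (R : realType) (k m m' e : nat) : (0 < k)%N ->
  (m + m' = e * k)%N ->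
  cos (m%:R * (2 * pi / k%:R)) = cos (m'%:R * (2 * pi / k%:R)) :> R.
Proof.
move=> k0 h; have hm : m%:R = e%:R * k%:R - m'%:R :> R.
  by rewrite -natrM -h natrD addrK.
rewrite hm -[LHS]cosN -(cos_addn_2pi _ e); congr cos.
by rewrite -[pi in X in _ + X](pi_div_mul R k0); ring.
Qed.

Lemma sin_addn_mulk (R : realType) (k e : nat) (x : R) : (0 < k)%N ->
  sin ((e%:R * k%:R + x) * (pi / k%:R)) = (-1) ^+ e * sin (x * (pi / k%:R)).
Proof.
move=> k0; rewrite -sin_addn_pi; congr sin.
transitivity (x * (pi / k%:R) + e%:R * (k%:R * (pi / k%:R))); first by ring.
by rewrite pi_div_mul.
Qed.

Lemma sin_nat_ge0 (R : realType) (k m : nat) : (0 < k)%N -> (m <= k)%N ->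
  0 <= sin (m%:R * (pi / k%:R)) :> R.
Proof.
move=> k0 mk; apply: sin_ge0_pi; apply/andP; split.
  by rewrite mulr_ge0// divr_ge0// pi_ge0.
by rewrite -{2}(pi_div_mul R k0) ler_wpM2r ?ler_nat// divr_ge0// pi_ge0.
Qed.

Lemma sin_nat_gt0 (R : realType) (k m : nat) : (0 < m < k)%N ->
  0 < sin (m%:R * (pi / k%:R)) :> R.
Proof.
move=> /andP[m0 mk]; have k0 : (0 < k)%N by lia.
have pk : 0 < pi / k%:R :> R by rewrite divr_gt0// ?pi_gt0 ?ltr0n.
apply: sin_gt0_pi; rewrite mulr_gt0// ?ltr0n//=.
by rewrite -{2}(pi_div_mul R k0) ltr_pM2r// ltr_nat.
Qed.

Lemma sin_nat_neq0 (R : realType) (k m : nat) : ~~ (k %| m)%N -> (0 < k)%N ->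
  sin (m%:R * (pi / k%:R)) != 0 :> R.
Proof.
move=> km k0; rewrite [in m%:R](divn_eq m k) natrD natrM sin_addn_mulk//.
rewrite mulf_eq0 signr_eq0/= gt_eqF// sin_nat_gt0// ltn_pmod// lt0n andbT.
by move: km; rewrite /dvdn.
Qed.

(** With m = qk + r and 2 <= r < k, both arguments lie in the same half period, and the two signs
    (-1)^q cancel. *)
Lemma sin_sub2_ge0 (R : realType) (k m : nat) : (0 < k)%N -> (2 <= m %% k)%N ->
  0 <= sin (m%:R * (pi / k%:R)) * sin ((m%:R - 2) * (pi / k%:R)) :> R.
Proof.
move=> k0 m2; rewrite (divn_eq m k) natrD natrM -addrA !sin_addn_mulk//.
rewrite mulrACA -expr2 sqrr_sign mul1r -natrB//.
by rewrite mulr_ge0// sin_nat_ge0//; have := ltn_pmod m k0; lia.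
Qed.

(** The residue r of m satisfies r + 1 <= k, so neighbouring multiples of pi/k never lie strictly on
    opposite sides of a zero of sine. *)
Lemma sin_succ_ge0 (R : realType) (k m : nat) : (0 < k)%N ->
  0 <= sin (m%:R * (pi / k%:R)) * sin (m.+1%:R * (pi / k%:R)) :> R.
Proof.
move=> k0; rewrite -natr1 (divn_eq m k) natrD natrM -addrA !sin_addn_mulk//.
rewrite mulrACA -expr2 sqrr_sign mul1r natr1.
by have mk := ltn_pmod m k0; rewrite mulr_ge0// sin_nat_ge0// ltnW.
Qed.

(** Multiplying the residue by d gives i modulo k: residue 0 would force i = 0, and residue 1 would
    force i = d. *)
Lemma inv_mul_mod_ge2 (d d' c k i : nat) :
  (d * d' = c * k + 1)%N -> (0 < i < d)%N -> (2 * d <= k)%N ->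
  (2 <= (i * d') %% k)%N.
Proof.
move=> dd /andP[i0 id] dk.
have hr : (d * ((i * d') %% k) = i %[mod k])%N.
  by rewrite modnMmr mulnCA dd mulnDr mulnA muln1 modnMDl.
case: ((i * d') %% k)%N hr => [|[|//]].
  by rewrite muln0 mod0n modn_small; lia.
by rewrite muln1 !modn_small; lia.
Qed.

(** By symmetry take j <= 0. From the left end -(d-1), where the coefficient is 1, the successive
    differences stay nonnegative up to 0, so the coefficients do not decrease. *)
Lemma laurent_qcos_ge0 (R : realType) (d d' c k : nat) (j : int) :
  (d * d' = c * k + 1)%N -> (0 < d)%N -> (2 * d <= k)%N ->
  0 <= laurent_coef (qcos (d'%:R * (pi / k%:R) : R)) d.-1 j.
Proof.
move=> dd d0 dk; have k0 : (0 < k)%N by lia.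
set b := _ * _; set g := laurent_coef _ _.
wlog j0 : j / j <= 0 => [hw|].
  by case: (lerP j 0) => [/hw//|j0]; rewrite /g -laurent_coefN hw//; lia.
pose n := d.-1; pose h (i : nat) := g (i%:Z - n%:Z) - g (i%:Z - n%:Z - 1).
have h_ge0 i : (i <= n)%N -> 0 <= h i.
  elim: i => [|i IH] idn.
    rewrite /h sub0r /g laurent_coefN laurent_coef_lead.
    have -> : - n%:Z - 1 = - (n.+1%:Z) by lia.
    by rewrite laurent_coefN laurent_coef_small ?subr0//; lia.
  have := @laurent_diff_rec R b n (i.+1%:Z - n%:Z).
  rewrite -/g -/n /= subrK -/(h i.+1).
  have -> : i.+1%:Z - n%:Z - 1 = i%:Z - n%:Z by lia.
  rewrite -/(h i).
  have -> : (n.+2%:Z - (i.+1%:Z - n%:Z)) = (2 * d)%:Z - i.+1%:Z.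
    by rewrite /n in idn *; lia.
  (* With m = (i+1)d' and d d' = 1 modulo k, the recurrence reads h(i+1) sin(m pi/k) = h(i)
     sin((m-2) pi/k). *)
  pose m := (i.+1 * d')%N.
  have -> : (i.+1%:Z)%:~R * b = m%:R * (pi / k%:R).
    by rewrite -pmulrn /b /m natrM; ring.
  have -> : ((2 * d)%:Z - i.+1%:Z)%:~R * b =
      ((2 * c)%:R * k%:R + (2 - m%:R)) * (pi / k%:R).
    have ddR : d%:R * d'%:R = c%:R * k%:R + 1 :> R.
      by rewrite -!natrM dd natrD.
    rewrite rmorphB /= -!pmulrn /b /m !natrM.
    transitivity ((2 * (d%:R * d'%:R) - i.+1%:R * d'%:R) * (pi / k%:R) : R).
      by ring.
    by rewrite ddR; ring.
  rewrite sin_addn_mulk// exprM sqrrN expr1n expr1n mul1r.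
  have -> : (2 - m%:R) * (pi / k%:R) = - ((m%:R - 2) * (pi / k%:R)) :> R by ring.
  rewrite sinN mulrN => /eqP; rewrite subr_eq0 => /eqP e.
  have im : (0 < i.+1 < d)%N by rewrite /n in idn *; lia.
  have m2 := inv_mul_mod_ge2 dd im dk.
  (* Multiplying by the sine once more puts a positive square in place of a factor of unknown
     sign. *)
  have s0 : 0 < sin (m%:R * (pi / k%:R)) ^+ 2 :> R.
    rewrite exprn_even_gt0//= sin_nat_neq0//; apply/negP => /eqP.
    by rewrite /m => e0; rewrite e0 in m2.
  rewrite -(pmulr_lge0 _ s0) expr2 [h i.+1 * _]mulrA e -[_ * _ * _]mulrA.
  by rewrite [X in _ * X]mulrC mulr_ge0 ?sin_sub2_ge0// IH// ltnW.
have gE (i : nat) : (i <= n)%N -> 0 <= g (i%:Z - n%:Z).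
  elim: i => [|i IH] idn.
    by rewrite sub0r /g laurent_coefN laurent_coef_lead.
  have := h_ge0 _ idn; rewrite /h.
  have -> : i.+1%:Z - n%:Z - 1 = i%:Z - n%:Z by lia.
  by have := IH (ltnW idn); lra.
case: (lerP (- n%:Z) j) => [nj|jn].
  have -> : j = (`|(j + n%:Z)%R|%N)%:Z - n%:Z by lia.
  by apply: gE; lia.
by rewrite /g -laurent_coefN laurent_coef_small//; rewrite -/n; lia.
Qed.

(** * The roots of L0 and its cosine expansion *)

(** [k] is a unit modulo [d]; this lets the roots of L0 be indexed by r = sk mod d. *)
Lemma perm_mulk (d k : nat) : coprime k d ->
  perm_eq [seq (s * k %% d)%N | s <- index_iota 1 d] (index_iota 1 d).
Proof.
move=> kd.
have inj : {in index_iota 1 d &, injective (fun s => s * k %% d)%N}.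
  move=> s t; rewrite !mem_index_iota.
  wlog st : s t / (t <= s)%N => [hw hs ht e|hs ht /eqP].
    by case: (leqP t s) => [/hw|/ltnW/hw h]; [|apply/esym]; auto.
  rewrite eqn_mod_dvd ?leq_mul2r ?st ?orbT// -mulnBl.
  rewrite Gauss_dvdl 1?coprime_sym// /dvdn modn_small; last lia.
  by move/eqP; lia.
have u : uniq [seq (s * k %% d)%N | s <- index_iota 1 d].
  by rewrite map_inj_in_uniq// iota_uniq.
apply: uniq_perm => //; first exact: iota_uniq.
have sub : {subset [seq (s * k %% d)%N | s <- index_iota 1 d]
              <= index_iota 1 d}.
  move=> _ /mapP[s hs ->]; rewrite mem_index_iota in hs.
  rewrite mem_index_iota ltn_mod andbC; apply/andP; split; first by lia.
  rewrite lt0n -/(dvdn d _) Gauss_dvdl 1?coprime_sym//.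
  by apply/negP => /dvdn_leq; lia.
by have [] := uniq_min_size u sub; rewrite ?size_map.
Qed.

(** With sk = md + r, multiplication by d' gives 0 = m + r d' modulo k, and cosine is even. *)
Lemma circ_cos_inv (R : realType) (d d' c k s : nat) :
  (d * d' = c * k + 1)%N -> (0 < k)%N ->
  circ_cos R k d s = cos ((s * k %% d * d')%:R * (2 * pi / k%:R)).
Proof.
move=> dd k0; pose m := (s * k %/ d)%N; pose r := (s * k %% d)%N.
have : (k %| m + r * d')%N.
  have : (k %| (m * d + r) * d')%N by rewrite /m /r -divn_eq mulnAC dvdn_mull.
  rewrite mulnDl -mulnA dd mulnDr muln1 -addnA dvdn_addr//.
  by rewrite mulnA dvdn_mull.
by case/dvdnP => e /(cos_2pi_opp R k0).
Qed.

Lemma circ_cos_lt1 (R : realType) (d k s : nat) :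
  (d <= k)%N -> (0 < s < d)%N -> 0 < 1 - circ_cos R k d s.
Proof.
move=> dk sd; rewrite /circ_cos -[X in X - _]cos0 -[X in cos X - _](mulr0 2).
have -> : (s * k %/ d)%:R * (2 * pi / k%:R) =
  2 * ((s * k %/ d)%:R * (pi / k%:R)) :> R by ring.
rewrite cos_sub_cos add0r sub0r sinN mulrN -mulrA mulNr opprK -expr2.
rewrite mulr_gt0// exprn_gt0// sin_nat_gt0//.
by rewrite divn_gt0 ?ltn_divLR; nia.
Qed.

Lemma circ_L0_inv (R : realType) (d d' c k : nat) (y : R) :
  (d * d' = c * k + 1)%N -> coprime k d -> (0 < k)%N ->
  circ_L0 k d y =
  \prod_(1 <= r < d) ((y - cos ((r * d')%:R * (2 * pi / k%:R))) /
                      (1 - cos ((r * d')%:R * (2 * pi / k%:R)))).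
Proof.
move=> dd kd k0; rewrite /circ_L0 -[RHS](perm_big _ (perm_mulk kd)) big_map.
by apply: eq_bigr => s _; rewrite (circ_cos_inv _ _ dd).
Qed.

Lemma circ_L0_1 (R : realType) (d k : nat) : (d <= k)%N ->
  circ_L0 k d (1 : R) = 1.
Proof.
move=> dk; rewrite /circ_L0 big_nat big1// => s sd.
by rewrite divff// gt_eqF// circ_cos_lt1.
Qed.

Lemma circ_L0_cos (R : realType) (d k : nat) :
  (0 < d)%N -> (2 * d <= k)%N -> coprime k d ->
  exists2 c : nat -> R, forall r, 0 <= c r &
    forall t, circ_L0 k d (cos t) = \sum_(0 <= r < d) c r * cos (r%:R * t).
Proof.
move=> d0 dk kd; have [d' [e dd]] := coprime_invn d0 kd.
have k0 : (0 < k)%N by lia.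
pose b : R := d'%:R * (pi / k%:R).
pose P : R := \prod_(1 <= s < d) (2 * (1 - circ_cos R k d s)).
have P0 : 0 < P.
  rewrite /P big_nat; elim/big_ind : _ => [//|x y|s hs]; first exact: mulr_gt0.
  by rewrite mulr_gt0// circ_cos_lt1//; lia.
pose g := laurent_coef (qcos b) d.-1.
(* Folding z^r with z^-r doubles every coefficient but the constant one; [P] collects the
   denominators of L0 with a factor 2 each. *)
exists (fun r => (if r == 0%N then 1 else 2) * g r / P) => [r|t].
  rewrite divr_ge0 ?(ltW P0)// mulr_ge0//; first by case: ifP.
  exact: (laurent_qcos_ge0 _ _ dd).
have -> : \sum_(0 <= r < d) (if r == 0%N then 1 else 2) * g r / P
    * cos (r%:R * t) = cos_sum g d.-1 t / P.
  rewrite big_ltn// big_add1 mul0r cos0 /cos_sum mulrDl mulr_sumr mulr_suml.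
  by congr (_ + _) => /=; [|apply: eq_bigr => r _]; ring.
rewrite cos_sum_laurent//.
have -> : \prod_(0 <= r < d.-1) (2 * (cos t - qcos b r)) =
    \prod_(1 <= s < d) (2 * (cos t - circ_cos R k d s)).
  transitivity (\prod_(1 <= r < d)
    (2 * (cos t - cos ((r * d')%:R * (2 * pi / k%:R))))).
    rewrite big_add1; apply: eq_bigr => r _; rewrite /qcos /b natrM.
    by congr (_ * (_ - cos _)); ring.
  rewrite -[LHS](perm_big _ (perm_mulk kd)) big_map.
  by apply: eq_bigr => s _; rewrite (circ_cos_inv _ _ dd).
rewrite /P -prodf_div; apply: eq_bigr => s _.
by rewrite invfM mulrACA divff// mul1r.
Qed.

(** * The theta number *)

(** Factors are peeled off from both ends, so that each meets its mirror image and at most a middle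
    one stays alone. *)
Lemma prod_ge0_rev (R : realType) (m : nat) (F : nat -> R) :
  (forall i j, (i + j).+1 = m -> i != j -> 0 <= F i * F j) ->
  (forall i, (i + i).+1 = m -> 0 <= F i) ->
  0 <= \prod_(0 <= i < m) F i.
Proof.
elim/ltn_ind: m F => -[|[|m]] IH F hp hm; first by rewrite big_geq.
  by rewrite big_nat1 hm.
rewrite big_nat_recl// big_nat_recr//= mulrCA mulrC mulr_ge0//.
  by rewrite mulrC; apply: hp => //; lia.
apply: IH => // [i j ij neq|i ii]; last by apply: hm; lia.
by apply: hp; lia.
Qed.

(** As [d] does not divide ik, the floors of ik/d and jk/d add up to k - 1; hence root j is also the
    cosine at m + 1. *)
Lemma circ_cos_pair (R : realType) (d k i j : nat) (x : nat) :
  (i + j = d)%N -> (0 < i)%N -> (0 < j)%N -> (d <= k)%N -> coprime k d ->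
  let y := cos (x%:R * (2 * pi / k%:R)) : R in
  let m := (i * k %/ d)%N in
  [/\ y - circ_cos R k d i = - 2 * sin ((x + m)%:R * (pi / k%:R))
                                 * sin ((x%:R - m%:R) * (pi / k%:R)) &
      y - circ_cos R k d j = - 2 * sin ((x + m.+1)%:R * (pi / k%:R))
                                 * sin ((x%:R - m.+1%:R) * (pi / k%:R))].
Proof.
move=> ijd i0 j0 dk kd y m.
have k0 : (0 < k)%N by lia.
have yE n : y - cos (n%:R * (2 * pi / k%:R)) =
    - 2 * sin ((x + n)%:R * (pi / k%:R)) * sin ((x%:R - n%:R) * (pi / k%:R)).
  rewrite natrD (mulrDl x%:R n%:R) mulrBl -cos_sub_cos /y.
  by congr (cos _ - cos _); ring.
split; first exact: yE.
rewrite -yE /circ_cos; congr (_ - _).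
apply: (@cos_2pi_opp R k (j * k %/ d) m.+1 1) => //.
have r0 : (0 < i * k %% d)%N.
  rewrite lt0n -/(dvdn d _) Gauss_dvdl 1?coprime_sym//.
  by apply/negP => /dvdn_leq; lia.
have rd : (i * k %% d < d)%N by rewrite ltn_mod; lia.
have -> : (j * k %/ d = k - m.+1)%N.
  have := divn_eq (i * k) d; rewrite -/m; set r := (i * k %% d)%N => E.
  have -> : (j * k = (k - m.+1) * d + (d - r))%N.
    have : (m < k)%N by rewrite ltn_divLR; nia.
    by rewrite /r; nia.
  by rewrite divnMDl ?divn_small ?addn0//; lia.
have : (m < k)%N by rewrite ltn_divLR; nia.
by lia.
Qed.

Lemma circ_L0_grid_ge0 (R : realType) (d k x : nat) :
  (d <= k)%N -> coprime k d ->
  0 <= circ_L0 k d (cos (x%:R * (2 * pi / k%:R))) :> R.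
Proof.
move=> dk kd; have [d1|d1] := leqP d 1; first by rewrite /circ_L0 big_geq.
have k0 : (0 < k)%N by lia.
set y := cos _.
rewrite /circ_L0 prodf_div divr_ge0//; last first.
  by rewrite big_nat prodr_ge0// => s sd; rewrite ltW// circ_cos_lt1.
pose s n : R := sin (n * (pi / k%:R)).
have sk n : s n = - s (n + k%:R).
  by rewrite /s (mulrDl n) pi_div_mul// sinDpi opprK.
have s2 m : (m < k)%N ->
    0 <= s (x + m)%:R * s (x + m.+1)%:R /\
    0 <= s (x%:R - m%:R) * s (x%:R - m.+1%:R).
  move=> mk; split; first by rewrite addnS; exact: sin_succ_ge0.
  rewrite (sk (x%:R - m%:R)) (sk (x%:R - m.+1%:R)) mulrNN mulrC.
  have -> : x%:R - m.+1%:R + k%:R = (x + (k - m.+1))%:R :> R.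
    by rewrite natrD natrB//; ring.
  have -> : x%:R - m%:R + k%:R = (x + (k - m.+1)).+1%:R :> R.
    by rewrite -natr1 natrD natrB// -natr1; ring.
  exact: sin_succ_ge0.
have mk i : (i < d)%N -> (i * k %/ d < k)%N by move=> ?; rewrite ltn_divLR; nia.
(* Mirror factors contribute four sines, which form two products at neighbouring arguments. *)
rewrite big_add1; apply: prod_ge0_rev => [i j ij _|i ii].
  have [] := @circ_cos_pair R d k i.+1 j.+1 x ltac:(lia) isT isT dk kd.
  move=> -> ->; have [] := s2 _ (mk i.+1 ltac:(lia)); rewrite /s.
  set m := (_ %/ _)%N => h1 h2.
  have := mulr_ge0 h1 h2; set A := sin _; set B := sin _; set C := sin _.
  set D := sin _ => h.
  have -> : - 2 * A * C * (- 2 * B * D) = 4 * (A * B * (C * D)) by ring.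
  by rewrite mulr_ge0.
(* For even d the root of index d/2 stays single; there x - m is x + m + 1 modulo k, so its two
   sines are again neighbours up to sign. *)
have [] := @circ_cos_pair R d k i.+1 i.+1 x ltac:(lia) isT isT dk kd.
move=> e1 e2; have [h1 h2] := s2 _ (mk i.+1 ltac:(lia)).
move: e1 e2; rewrite -/y.
set m := (i.+1 * k %/ d)%N in h1 h2 *.
(* The remainder is a multiple of d/2 strictly between 0 and d, hence d/2 itself, which gives k = 2m
   + 1. *)
have km : (k = m + m.+1)%N.
  have := divn_eq (i.+1 * k) d; rewrite -/m.
  have : (i.+1 * k %% d < d)%N by rewrite ltn_mod; lia.
  have dE : d = (i.+1 * 2)%N by lia.
  have r0 : (0 < i.+1 * k %% d)%N.
    rewrite lt0n -/(dvdn d _) Gauss_dvdl 1?coprime_sym//.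
    by apply/negP => /dvdn_leq; lia.
  have : (i.+1 %| i.+1 * k %% d)%N.
    by rewrite /dvdn modn_dvdm ?dE ?dvdn_mulr// -/(dvdn _ _) dvdn_mulr.
  move: r0; set r := (_ %% _)%N => r0 /dvdnP[q rq] rd E.
  have q1 : q = 1%N by nia.
  by move: E; rewrite rq q1; nia.
move=> -> _.
have := sk (x%:R - m%:R).
have -> : x%:R - m%:R + k%:R = (x + m.+1)%:R :> R by rewrite {1}km !natrD; ring.
by move: h1; rewrite /s => + ->; lra.
Qed.

(** * Trigonometric sums and positive semidefinite forms *)

(** Multiplied by 2 sin u, nonzero as [k] does not divide [m], the sum telescopes, and the end
    arguments differ by a multiple of 2 pi. *)
Lemma sum_cos_eq0 (R : realType) (k m : nat) (p : R) : ~~ (k %| m)%N ->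
  \sum_(x < k) cos (x%:R * (m%:R * (2 * pi / k%:R)) + p) = 0.
Proof.
move=> km; have [->|k0] := posnP k; first by rewrite big_ord0.
pose u := m%:R * (pi / k%:R) : R.
have s0 : 2 * sin u != 0 by rewrite mulf_neq0 ?pnatr_eq0// sin_nat_neq0.
apply: (mulfI s0); rewrite mulr0 mulr_sumr.
pose F n : R := sin (n%:R * (2 * u) + (p - u)).
rewrite -(big_mkord xpredT (fun x =>
  2 * sin u * cos (x%:R * (m%:R * (2 * pi / k%:R)) + p))).
rewrite (eq_bigr (fun n => F n.+1 - F n)); last first.
  move=> n _; rewrite mulrAC.
  have -> : n%:R * (m%:R * (2 * pi / k%:R)) + p = n%:R * (2 * u) + p.
    by rewrite /u; ring.
  rewrite cos_mul_sin /F -natr1.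
  by congr (sin _ - sin _); ring.
rewrite telescope_sumr// /F mul0r add0r.
have -> : k%:R * (2 * u) = (m * 2)%:R * pi :> R.
  by rewrite -[pi in RHS](pi_div_mul R k0) /u natrM; ring.
by rewrite [X in sin X - _]addrC sin_addn_pi mulnC exprM sqrrN !expr1n mul1r
  subrr.
Qed.

Lemma quad_formE (R : realType) (n : nat) (B : 'M[R]_n) (v : 'cV[R]_n) :
  (v^T *m B *m v) 0 0 = \sum_x \sum_y v x 0 * v y 0 * B x y.
Proof.
rewrite exchange_big mxE; apply: eq_bigr => y _.
by rewrite mxE mulr_suml; apply: eq_bigr => x _; rewrite mxE; ring.
Qed.

(** By cos(s - t) = cos s cos t + sin s sin t, this is the quadratic form of [B] at a cosine vector
    plus that at a sine vector. *)
Lemma psd_cos_ge0 (R : realType) (n : nat) (B : 'M[R]_n) (a : R) :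
  psdmx B -> 0 <= \sum_(x < n) \sum_(y < n) B x y * cos (a * (x%:R - y%:R)).
Proof.
move=> [_ Bpsd].
have := addr_ge0 (Bpsd (\col_x cos (a * x%:R))) (Bpsd (\col_x sin (a * x%:R))).
rewrite !quad_formE -big_split/=; congr (_ <= _).
apply: eq_bigr => x _; rewrite -big_split; apply: eq_bigr => y _ /=.
by rewrite !mxE mulrBr cosB; ring.
Qed.

Lemma cos_distn (R : realType) (a : R) (x y : nat) :
  cos (a * (x%:R - y%:R)) = cos (`|x - y|%N%:R * a).
Proof.
case: (leqP x y) => [xy|/ltnW xy].
  by rewrite distnEr// natrB// -[RHS]cosN; congr cos; ring.
by rewrite distnEl// natrB//; congr cos; ring.
Qed.

(** * Both bounds on theta from a cosine expansion of degree below d *)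

Section ThetaOfCosineExpansion.
Variables (R : realType) (d k : nat) (P : R -> R) (c : nat -> R).
Hypotheses (d0 : (0 < d)%N) (dk : (2 * d <= k)%N).
Hypothesis PE : forall t, P (cos t) = \sum_(0 <= r < d) c r * cos (r%:R * t).

Let k0 : (0 < k)%N. Proof. by move: d0 dk; lia. Qed.
Let w : R := 2 * pi / k%:R.

(** Only the constant term survives: for 0 < r < d, [k] does not divide rm, since [m] is a unit and
    r < k. *)
Lemma sum_cos_modulated (m : nat) (p : R) : coprime k m ->
  \sum_(x < k) P (cos (x%:R * (m%:R * w) + p)) = k%:R * c 0.
Proof.
move=> km; under eq_bigr do rewrite PE.
rewrite exchange_big big_ltn//= [X in _ + X]big_nat.
rewrite [X in _ + X]big1 => [|r /andP[r0 rd]].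
  under eq_bigr do rewrite mul0r cos0 mulr1.
  by rewrite sumr_const card_ord addr0 mulr_natl.
rewrite -mulr_sumr.
rewrite (eq_bigr (fun x : 'I_k => cos (x%:R * ((r * m)%:R * w) + r%:R * p))).
  rewrite sum_cos_eq0 ?mulr0//.
  by rewrite Gauss_dvdl//; apply/negP => /dvdn_leq; move: dk; lia.
by move=> x _; congr cos; rewrite natrM; ring.
Qed.

(** Expanding gives the frequencies D - r and D + r with r < d, all strictly between 0 and k. *)
Lemma sum_cos_far (D : nat) : (d <= D <= k - d)%N ->
  \sum_(j < k) P (cos (j%:R * w)) * cos (D%:R * (j%:R * w)) = 0.
Proof.
move=> hD; under eq_bigr do rewrite PE mulr_suml.
rewrite exchange_big big_nat big1// => r /andP[_ rd].
rewrite (eq_bigr (fun j : 'I_k => c r / 2 *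
  (cos (j%:R * ((r + D)%:R * w) + 0) + cos (j%:R * ((D - r)%:R * w) + 0)))).
  rewrite -mulr_sumr big_split/= !sum_cos_eq0 ?addr0 ?mulr0//;
  by apply/negP => /dvdn_leq; move: k0 dk; lia.
move=> j _; rewrite !addr0.
have -> : j%:R * ((r + D)%:R * w) = D%:R * (j%:R * w) + r%:R * (j%:R * w).
  by rewrite natrD; ring.
have -> : j%:R * ((D - r)%:R * w) = D%:R * (j%:R * w) - r%:R * (j%:R * w).
  by rewrite natrB; [ring | lia].
by rewrite -cos_mul_cos; field.
Qed.

(** Weak duality: weighting the nonnegative forms [S j] by P(cos(jw)) gives k c_0 in total, because
    the weights cancel on edges of K_{k/d} and [B] vanishes on the other off-diagonal pairs. *)
Lemma theta_le (B : 'M[R]_k) : P 1 = 1 ->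
  (forall j : nat, 0 <= P (cos (j%:R * w))) ->
  theta_feasible (complement_graph (circular_clique k d)) B ->
  \sum_x \sum_y B x y <= k%:R * c 0.
Proof.
move=> P1 Pge0 [Bpsd Btr Bz].
pose S (j : nat) : R := \sum_x \sum_y B x y * cos (j%:R * w * (x%:R - y%:R)).
have S0 : S 0%N = \sum_x \sum_y B x y.
  apply: eq_bigr => x _; apply: eq_bigr => y _.
  by rewrite !mul0r cos0 mulr1.
have S_ge0 j : 0 <= S j by exact: psd_cos_ge0.
have -> : k%:R * c 0 = \sum_(j < k) P (cos (j%:R * w)) * S j.
  under [RHS]eq_bigr do rewrite mulr_sumr.
  have -> : k%:R * c 0 = \sum_x k%:R * c 0 * B x x.
    by rewrite -mulr_sumr -/(\tr B) Btr mulr1.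
  rewrite exchange_big /=; apply: eq_bigr => x _.
  under [RHS]eq_bigr do rewrite mulr_sumr.
  rewrite exchange_big /= (bigD1 x)//= [X in _ + X]big1 => [|y yx].
    rewrite addr0 -(sum_cos_modulated 0 (coprimen1 k)) mulr_suml.
    apply: eq_bigr => j _; rewrite subrr mulr0 cos0 mulr1.
    by rewrite mul1r addr0.
  have [h|h] := boolP (circular_clique k d x y); last first.
    rewrite big1// => j _; rewrite Bz ?mul0r ?mulr0//.
    by rewrite /complement_graph eq_sym yx.
  under eq_bigr do rewrite mulrCA cos_distn.
  by rewrite -mulr_sumr sum_cos_far ?mulr0.
(* The term j = 0 is the value of [B], with weight P(1) = 1. *)
rewrite -S0 -(prednK k0) big_ord_recl/= mul0r cos0 P1 mul1r lerDl.
by apply: sumr_ge0 => j _; rewrite mulr_ge0.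
Qed.

Lemma theta_ge (d' e : nat) : (forall r, 0 <= c r) -> P 1 = 1 ->
  (d * d' = e * k + 1)%N ->
  (forall r, (0 < r < d)%N -> P (cos ((r * d')%:R * w)) = 0) ->
  theta_values (complement_graph (circular_clique k d)) (k%:R * c 0).
Proof.
move=> c_ge0 P1 dd Pz.
have kd' : coprime k d'.
  rewrite coprime_sym; apply/coprimeP; first by move: k0 dd; lia.
  by exists (d, e) => /=; nia.
pose Q (x y : nat) : R := P (cos (d'%:R * w * (x%:R - y%:R))).
exists (\matrix_(x, y) (k%:R^-1 * Q x y)).
  split.
  - split; first by apply/matrixP => x y; rewrite !mxE /Q -cosN -mulrN opprB.
    move=> v; rewrite quad_formE.
    (* The quadratic form becomes a combination of squares with the nonnegative coefficients
       c_r/k. *)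
    pose f (g : R -> R) r := \sum_(x < k) v x 0 * g (r%:R * (d'%:R * w * x%:R)).
    have -> : \sum_x \sum_y v x 0 * v y 0 *
        (\matrix_(x, y) (k%:R^-1 * Q x y)) x y = k%:R^-1 * \sum_(0 <= r < d) c r * (f cos r ^+ 2 + f sin r ^+ 2).
      rewrite mulr_sumr.
      transitivity (\sum_(x < k) \sum_(y < k) \sum_(0 <= r < d)
          k%:R^-1 * c r * (v x 0 * v y 0 *
            cos (r%:R * (d'%:R * w * (x%:R - y%:R))))).
        apply: eq_bigr => x _; apply: eq_bigr => y _.
        rewrite mxE /Q PE !mulr_sumr; apply: eq_bigr => r _; ring.
      under eq_bigr do rewrite exchange_big.
      rewrite exchange_big; apply: eq_bigr => r _ /=.
      rewrite !expr2 !mulr_suml -big_split/= !mulr_sumr.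
      apply: eq_bigr => x _; rewrite /f !mulr_sumr -big_split/= !mulr_sumr.
      by apply: eq_bigr => y _ /=; rewrite !mulrBr cosB; ring.
    rewrite mulr_ge0 ?invr_ge0// sumr_ge0// => r _.
    by rewrite mulr_ge0// addr_ge0// sqr_ge0.
  - rewrite /mxtrace (eq_bigr (fun=> k%:R^-1)) => [|x _].
      by rewrite sumr_const card_ord -[LHS]mulr_natl divff// pnatr_eq0 -lt0n.
    by rewrite mxE /Q subrr mulr0 cos0 P1 mulr1.
  - move=> x y /andP[xy ncl]; rewrite mxE /Q cos_distn.
    rewrite /circular_clique in ncl; set D := `|_ - _|%N in ncl *.
    have D0 : (0 < D < k)%N.
      rewrite /D lt0n distn_eq0 xy/=.
      by have := ltn_ord x; have := ltn_ord y; lia.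
    (* A pair of distinct vertices not adjacent in K_{k/d} has D < d or k - D < d; both give zeros
       of P, the second by evenness of cosine. *)
    rewrite mulrA -natrM; have [Dd|Dd] := ltnP D d.
      by rewrite Pz ?mulr0//; lia.
    rewrite (@cos_2pi_opp R k _ ((k - D) * d') d')//.
      by rewrite Pz ?mulr0//; lia.
    by rewrite -mulnDl subnKC ?[(k * _)%N]mulnC//; lia.
under eq_bigr do under eq_bigr do rewrite mxE.
(* Each row sums to c_0, since d' is coprime to k. *)
rewrite (eq_bigr (fun=> c 0)) => [|x _].
  by rewrite sumr_const card_ord mulr_natl.
rewrite -mulr_sumr.
rewrite (eq_bigr (fun y : 'I_k =>
  P (cos (y%:R * (d'%:R * w) + - (d'%:R * w * x%:R))))) => [|y _].
  by rewrite sum_cos_modulated// mulKf// pnatr_eq0 -lt0n.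
by rewrite /Q; congr (P _); rewrite -cosN; congr cos; ring.
Qed.

End ThetaOfCosineExpansion.

Lemma lovasz_theta_circ (R : realType) (d k : nat) (c : nat -> R) :
  (0 < d)%N -> (2 * d <= k)%N -> coprime k d -> (forall r, 0 <= c r) ->
  (forall t, circ_L0 k d (cos t) = \sum_(0 <= r < d) c r * cos (r%:R * t)) ->
  lovasz_theta R (complement_graph (circular_clique k d)) = k%:R * c 0.
Proof.
move=> d0 dk kd c0 LE; have k0 : (0 < k)%N by lia.
have dk' : (d <= k)%N by lia.
have [||[B fB <-] ub] :=
    @lovasz_theta_max R k (complement_graph (circular_clique k d)) => //.
  by move=> x; rewrite /complement_graph eqxx.
have [d' [e dd]] := coprime_invn d0 kd.
apply/eqP; rewrite eq_le; apply/andP; split.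
  apply: (theta_le d0 dk LE _ _ fB); first exact: circ_L0_1.
  by move=> j; exact: circ_L0_grid_ge0.
apply: ub; apply: (theta_ge d0 dk LE c0 _ dd); first exact: circ_L0_1.
move=> r rd; rewrite (circ_L0_inv _ dd)//; apply/eqP.
rewrite prodf_seq_eq0; apply/hasP; exists r; first by rewrite mem_index_iota.
by rewrite /= subrr mul0r eqxx.
Qed.

(** * Chebyshev integrals *)

(* The mean value over [0, pi], expressed through a primitive so that no
   integral has to be computed. *)
Definition half_mean (R : realType) (F : R -> R) (c : R) : Prop :=
  exists2 G : R -> R, forall t : R, is_derive t 1 G (F t) &
    G 0 = 0 /\ G pi = c * pi.

Lemma half_mean_ext (R : realType) (F1 F2 : R -> R) c1 c2 :
  F1 =1 F2 -> c1 = c2 -> half_mean F1 c1 -> half_mean F2 c2.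
Proof. by move=> /funext -> ->. Qed.

Lemma half_meanD (R : realType) (F1 F2 : R -> R) c1 c2 :
  half_mean F1 c1 -> half_mean F2 c2 ->
  half_mean (fun t => F1 t + F2 t) (c1 + c2).
Proof.
move=> [G1 d1 [a1 b1]] [G2 d2 [a2 b2]]; exists (G1 + G2) => [t|].
  exact: is_deriveD.
by rewrite !fctE a1 a2 b1 b2 addr0 mulrDl.
Qed.

Lemma half_meanZ (R : realType) (a : R) (F : R -> R) c :
  half_mean F c -> half_mean (fun t => a * F t) (a * c).
Proof.
move=> [G dG [G0 Gpi]]; exists (a \*: G) => [t|]; first exact: is_deriveZ.
by rewrite /= G0 Gpi scaler0 -mulrA.
Qed.

Lemma half_mean_sum (R : realType) (I : Type) (r : seq I) (Q : pred I)
    (F : I -> R -> R) (c : I -> R) :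
  (forall i, Q i -> half_mean (F i) (c i)) ->
  half_mean (fun t => \sum_(i <- r | Q i) F i t) (\sum_(i <- r | Q i) c i).
Proof.
move=> h; elim: r => [|i r IH].
  rewrite big_nil; exists (cst 0) => [t|]; last by rewrite mul0r.
  by rewrite big_nil; exact: is_derive_cst.
rewrite big_cons; case: ifP => Qi; last first.
  by apply: half_mean_ext IH => // t; rewrite big_cons Qi.
apply: half_mean_ext (half_meanD (h i Qi) IH) => // t.
by rewrite big_cons Qi.
Qed.

Lemma half_mean1 (R : realType) : half_mean (fun=> 1 : R) 1.
Proof. by exists id => [t|]; [exact: is_derive_id | rewrite mul1r]. Qed.

Lemma half_mean_cos (R : realType) (n : nat) : (0 < n)%N ->
  half_mean (fun t : R => cos (n%:R * t)) 0.
Proof.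
move=> n0; have nR : n%:R != 0 :> R by rewrite pnatr_eq0 -lt0n.
exists (n%:R^-1 \*: (sin \o (n%:R \*: id))) => [t|].
  have := is_deriveZ n%:R^-1 (is_derive1_comp (is_derive_sin (n%:R *: t))
    (is_deriveZ n%:R (is_derive_id t 1))).
  by move/is_derive_eq; apply; rewrite -![_ *: _]/(_ * _) mulr1 mulrCA mulVf
    ?mulr1.
rewrite /= -![_ *: _]/(_ * _) mulr0 sin0 mulr0 mul0r.
by rewrite -[n%:R * pi]add0r sin_addn_pi sin0 !mulr0.
Qed.

(** For n = 2j, the ratio of consecutive central binomial coefficients, in the shape produced by the
    reduction formula for powers of cosine. *)
Lemma central_binS (n : nat) : ~~ odd n ->
  (n.+2 * 'C(n.+2, n./2.+1) = n.+1 * 'C(n, n./2) * 4)%N.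
Proof.
move=> n_even; have nE := even_halfK n_even; set j := n./2 in nE *.
have h1 := mul_bin_diag n.+2 j; have h2 := mul_bin_down n.+1 j.
rewrite /= in h1 h2; have e : (n.+1 - j = j.+1)%N by lia.
rewrite e in h2; apply/eqP; rewrite -(eqn_pmul2l (ltn0Sn j)); apply/eqP.
by rewrite mulnCA -h1 h2; nia.
Qed.

(** The reduction formula for cos^(n+2): integration by parts leaves the boundary term sin
    cos^(n+1), zero at both ends. *)
Lemma half_mean_cos_expr (R : realType) (n : nat) :
  half_mean (fun t : R => cos t ^+ n)
    (if odd n then 0 else 'C(n, n./2)%:R / 2 ^+ n).
Proof.
elim/ltn_ind: n => -[|[|n]] IH.
- by apply: half_mean_ext (half_mean1 R) => //=; rewrite bin0 divr1.
- apply: half_mean_ext (half_mean_cos R (ltn0Sn 0)) => // t.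
  by rewrite mul1r expr1.
have [G dG [G0 Gpi]] := IH n ltac:(lia).
have n2 : n.+2%:R != 0 :> R by rewrite pnatr_eq0.
exists (n.+2%:R^-1 \*: (sin * cos ^+ n.+1 + n.+1%:R \*: G)) => [t|].
  have := is_deriveZ n.+2%:R^-1 (is_deriveD
    (is_deriveM (is_derive_sin t) (is_deriveX n.+1 (is_derive_cos t)))
    (is_deriveZ n.+1%:R (dG t))).
  move/is_derive_eq; apply; rewrite -![_ *: _]/(_ * _) !fctE /=.
  apply: (mulfI n2); rewrite mulVKf//.
  rewrite -[n.+2%:R]natr1 !exprS.
  have -> : sin t * (n.+1%:R * cos t ^+ n * - sin t) =
    - (n.+1%:R * cos t ^+ n * sin t ^+ 2) by ring.
  by rewrite sin2cos2; ring.
rewrite !fctE /= G0 Gpi sin0 sinpi !mul0r !add0r -![_ *: _]/(_ * _) !mulr0.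
split=> //; rewrite negbK; case: ifPn => n_odd; first by rewrite !mul0r !mulr0.
have /(congr1 (fun m => m%:R : R)) := central_binS n_odd; rewrite !natrM => e.
rewrite !mulrA; congr (_ * _); apply: (mulfI n2).
rewrite [RHS]mulrA e !mulrA divff// mul1r !exprS.
by field; rewrite expf_neq0 ?pnatr_eq0.
Qed.

(** * From primitives to the Lebesgue integral with weight 1/sqrt(1 - y^2) *)

Lemma integrand_continuous (R : realType) (f : R -> R) (y : R) :
  continuous f -> -1 < y < 1 ->
  {for y, continuous (fun y => f y / Num.sqrt (1 - y ^+ 2))}.
Proof.
move=> cf /andP[y1 y2].
have sq : Num.sqrt (1 - y ^+ 2) != 0 :> R.
  by rewrite gt_eqF// sqrtr_gt0; nra.
apply: cvgM; first exact: cf.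
apply: cvgV => //; apply: continuous_cvg; first exact: sqrt_continuous.
by apply: cvgB; [exact: cvg_cst | exact: exprn_continuous].
Qed.

Lemma cos_lt_pi (R : realType) (x y : R) :
  0 <= x -> x < y -> y <= pi -> cos y < cos x.
Proof.
by move=> x0 xy ypi; rewrite ltr_cos// in_itv/=; apply/andP; split; lra.
Qed.

(** The substitution y = cos t: [- (G \o acos)] is a primitive of the integrand. The cut [s] keeps
    away from the singularities at -1 and 1. *)
Lemma half_mean_integral_itv (R : realType) (f G : R -> R) (s : R) :
  continuous f -> (forall t : R, is_derive t 1 G (f (cos t))) ->
  0 < s -> s < pi / 2 ->
  (\int[lebesgue_measure]_(y in `[cos (pi - s), cos s])
    (f y / Num.sqrt (1 - y ^+ 2)%R)%:E = (G (pi - s) - G s)%:E)%E.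
Proof.
move=> cf dG s0 spi.
have [pi0 hp] : 0 < pi :> R /\ s < pi - s by split; [exact: pi_gt0 | lra].
have ab : cos (pi - s) < cos s by apply: cos_lt_pi; lra.
have abE y : cos (pi - s) <= y <= cos s -> -1 < y < 1.
  move=> /andP[y1 y2]; apply/andP; split.
    by apply: lt_le_trans y1; rewrite -cospi; apply: cos_lt_pi; lra.
  by apply: le_lt_trans y2 _; rewrite -cos0; apply: cos_lt_pi; lra.
have dF (y : R) : -1 < y < 1 ->
    is_derive y 1 (- (G \o acos)) (f y / Num.sqrt (1 - y ^+ 2)).
  move=> y1.
  have := is_deriveN (is_derive1_comp (dG (acos y)) (is_derive1_acos y1)).
  move/is_derive_eq; apply; rewrite acosK ?mulrN ?opprK// in_itv /=.
  by move: y1 => /andP[/ltW -> /ltW ->].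
rewrite (@continuous_FTC2 _ _ (- (G \o acos)))//.
- rewrite !fctE /= !cosK ?in_itv /=; [|lra..].
  by rewrite -EFinB opprK addrC.
- apply: continuous_in_subspaceT => y; rewrite inE/= in_itv/= => /abE.
  exact: integrand_continuous.
- have cF y : cos (pi - s) <= y <= cos s -> {for y, continuous (- (G \o acos))}.
    move=> /abE /dF[dFy _]; apply: differentiable_continuous.
    exact/derivable1_diffP.
  split.
  + move=> y; rewrite in_itv/= => /andP[/ltW y1 /ltW y2].
    by have [|] := dF y; first by apply: abE; rewrite y1.
  + by apply: cvg_at_right_filter; apply: cF; rewrite lexx ltW.
  + by apply: cvg_at_left_filter; apply: cF; rewrite lexx ltW.
- move=> y; rewrite in_itv/= => /andP[/ltW y1 /ltW y2].
  rewrite derive1E; apply: derive_val.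
  by apply: dF; apply: abE; rewrite y1.
Qed.

Lemma integrand_measurable (R : realType) (f : R -> R) : continuous f ->
  measurable_fun `](-1 : R), 1[ (fun y : R => f y / Num.sqrt (1 - y ^+ 2)).
Proof.
move=> cf; apply: open_continuous_measurable_fun => [|y].
  exact: interval_open.
by rewrite inE/= in_itv/= => /(integrand_continuous cf).
Qed.

(** Monotone convergence along the intervals [cos(pi - s), cos s] as s decreases to 0; continuity of
    [G] gives the limit. *)
Lemma half_mean_integral_ge0 (R : realType) (f : R -> R) c :
  continuous f -> (forall y, -1 < y < 1 -> 0 <= f y) ->
  half_mean (fun t => f (cos t)) c ->
  (\int[lebesgue_measure]_(y in `](-1 : R)%R, 1%R[)
    (f y / Num.sqrt (1 - y ^+ 2)%R)%:E = (c * pi)%:E)%E.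
Proof.
move=> cf f_ge0 [G dG [G0 Gpi]].
(* The offset 2 makes every [s n] less than 1, hence less than pi/2. *)
pose s n : R := n.+2%:R^-1.
have hpi := pihalf_ge1 R.
have s0 n : 0 < s n by rewrite invr_gt0.
have s1 n : s n < pi / 2.
  by apply: lt_le_trans hpi; rewrite invf_lt1 ?ltr0n// ltr1n.
have s_le m n : (m <= n)%N -> s n <= s m.
  by move=> mn; rewrite lef_pV2 ?posrE ?ltr0n// ler_nat.
have cos_le (x y : R) : 0 <= x -> x <= y -> y <= pi -> cos y <= cos x.
  move=> x0; rewrite le_eqVlt => /predU1P[->//|xy] ypi.
  by apply/ltW/cos_lt_pi.
pose D n : set R := `[cos (pi - s n), cos (s n)]%classic.
have DU : \bigcup_n D n = `](-1 : R), 1[%classic.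
  apply/seteqP; split => [y [n _]|y]; rewrite /D/= !in_itv/= => /andP[y1 y2].
    have := s0 n; have := s1 n => sn1 sn0; apply/andP; split.
      by apply: lt_le_trans y1; rewrite -cospi; apply: cos_lt_pi; lra.
    by apply: le_lt_trans y2 _; rewrite -cos0; apply: cos_lt_pi; lra.
  have a0 : 0 < acos y by rewrite acos_gt0// (ltW y1).
  have a1 : 0 < pi - acos y by rewrite subr_gt0 acos_ltpi// y1 ltW.
  (* An index with [s n] at most the distance from acos y to both ends of [0, pi] puts y in
     [D n]. *)
  pose e := Num.min (acos y) (pi - acos y).
  have e0 : 0 < e by rewrite /e lt_min a0.
  pose n := Num.truncn e^-1; exists n => //=; rewrite in_itv/=.
  have sne : s n <= e.
    rewrite /s invf_ple ?posrE ?ltr0n//.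
    apply: ltW; apply: lt_trans (truncnS_gt _) _; by rewrite ltr_nat.
  have [ea eb] : s n <= acos y /\ s n <= pi - acos y.
    by move: sne; rewrite /e le_min => /andP[].
  have yE : cos (acos y) = y by rewrite acosK// in_itv/= !ltW.
  have := s0 n; move=> sn0.
  by rewrite -[y in X in X && _]yE -[y in X in _ && X]yE; apply/andP; split;
    apply: cos_le; lra.
have DS n : D n `<=` `](-1 : R), 1[%classic by rewrite -DU; exact: bigcup_sup.
have cvgI : (\int[lebesgue_measure]_(y in D n)
      (f y / Num.sqrt (1 - y ^+ 2)%R)%:E)%E @[n --> \oo] -->
    (\int[lebesgue_measure]_(y in `](-1 : R)%R, 1%R[)
      (f y / Num.sqrt (1 - y ^+ 2)%R)%:E)%E.
  rewrite -DU; apply: ge0_nondecreasing_set_cvg_integral.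
  - move=> m n mn; apply/subsetPset => y; rewrite /D/= !in_itv/=.
    move=> /andP[y1 y2]; have := s_le _ _ mn; have := s0 n; have := s1 m.
    move=> sm sn smn; apply/andP; split.
      by apply: le_trans y1; apply: cos_le; lra.
    by apply: le_trans y2 _; apply: cos_le; lra.
  - by move=> n; exact: measurable_itv.
  - move=> n; apply/measurable_EFinP.
    by apply: measurable_funS (integrand_measurable cf).
  - move=> n y /DS/=; rewrite in_itv/= => y1.
    by rewrite lee_fin divr_ge0// ?sqrtr_ge0// f_ge0.
apply: (cvg_unique (@ereal_hausdorff R) cvgI).
have -> : (fun n => \int[lebesgue_measure]_(y in D n)
      (f y / Num.sqrt (1 - y ^+ 2)%R)%:E)%E =
    EFin \o (fun n => G (pi - s n) - G (s n)).
  by apply/funext => n; rewrite (half_mean_integral_itv cf dG).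
apply: cvg_EFin; first exact: nearW.
have cG (x : R) : {for x, continuous G}.
  by have [dGx _] := dG x; apply/differentiable_continuous/derivable1_diffP.
have s_cvg : s n @[n --> \oo] --> (0 : R).
  by have := @cvg_harmonic R; rewrite -cvg_shiftS.
have -> : c * pi = G (pi - 0) - G 0 by rewrite subr0 G0 Gpi subr0.
apply: cvgB.
  apply: continuous_cvg; first exact: cG.
  by apply: cvgB => //; exact: cvg_cst.
by apply: continuous_cvg => //; exact: cG.
Qed.

(** Adding a constant [M] makes f nonnegative; the integral of the constant is then subtracted, both
    being finite. The endpoints have measure zero. *)
Lemma half_mean_integral (R : realType) (f : R -> R) c :
  continuous f -> half_mean (fun t => f (cos t)) c ->
  (\int[lebesgue_measure]_(y in `[(-1 : R)%R, 1%R])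
    (f y / Num.sqrt (1 - y ^+ 2)%R)%:E = (c * pi)%:E)%E.
Proof.
move=> cf mf; rewrite integral_itv_bndoo; last first.
  by apply/measurable_EFinP; exact: integrand_measurable.
have [x _ xmin] : exists2 x : R, x \in `[(-1 : R), 1] &
    forall y, y \in `[(-1 : R), 1] -> f x <= f y.
  by apply: EVT_min; [lra | exact: continuous_subspaceT].
pose M := `|f x|; have M0 : 0 <= M by exact: normr_ge0.
have fM y : -1 < y < 1 -> 0 <= f y + M.
  move=> /andP[y1 y2]; have /xmin : y \in `[(-1 : R), 1].
    by rewrite in_itv/= !ltW.
  by have := ler_norm (- f x); rewrite normrN -/M; lra.
have mM : half_mean (fun=> M) M.
  by apply: half_mean_ext (half_meanZ M (half_mean1 R)) => [t|]; rewrite mulr1.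
have cM : continuous (fun _ : R => M) by exact: cst_continuous.
have cfM : continuous (fun y => f y + M).
  by move=> y; apply: cvgD; [exact: cf | exact: cvg_cst].
have I1 := half_mean_integral_ge0 cfM fM (half_meanD mf mM).
have I2 := half_mean_integral_ge0 cM (fun _ _ => M0) mM.
have integrable (g : R -> R) r : continuous g ->
    (forall y, -1 < y < 1 -> 0 <= g y) ->
    (\int[lebesgue_measure]_(y in `](-1 : R)%R, 1%R[)
      (g y / Num.sqrt (1 - y ^+ 2)%R)%:E = r%:E)%E ->
    lebesgue_measure.-integrable `](-1 : R), 1[
      (EFin \o (fun y : R => g y / Num.sqrt (1 - y ^+ 2))).
  move=> cg g0 Ig; apply/integrableP; split.
    by apply/measurable_EFinP; exact: integrand_measurable.
  rewrite (_ : integral _ _ _ = r%:E) ?ltry// -Ig; apply: eq_integral => y.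
  rewrite inE/= in_itv/= => y1.
  by rewrite /= ger0_norm// divr_ge0 ?sqrtr_ge0 ?g0.
transitivity (\int[lebesgue_measure]_(y in `](-1 : R)%R, 1%R[)
    (((f y + M) / Num.sqrt (1 - y ^+ 2)%R)%:E
     - (M / Num.sqrt (1 - y ^+ 2)%R)%:E))%E.
  by apply: eq_integral => y _; rewrite -EFinB -mulrBl addrK.
rewrite integralB_EFin//.
- by rewrite I1 I2 -EFinB mulrDl addrK.
- exact: (integrable _ _ cfM fM I1).
- exact: (integrable _ _ cM (fun _ _ => M0) I2).
Qed.

(** * The closed formula with elementary symmetric polynomials *)

(** Vieta: choosing -x_i exactly on a subset A contributes to y^(n-#|A|), so subsets are grouped by
    that exponent. *)
Lemma prod_sub_elem_sym (R : realType) (n : nat) (x : 'I_n -> R) (y : R) :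
  \prod_i (y - x i) =
  \sum_(m < n.+1) (-1) ^+ (n - m) * elem_sym (n - m) x * y ^+ m.
Proof.
under eq_bigr do rewrite addrC.
rewrite bigA_distr.
(* The exponent is at most n, so [inord] never takes its default value. *)
rewrite (partition_big (fun A : {set 'I_n} => inord (n - #|A|) : 'I_n.+1)
  xpredT)//=.
apply: eq_bigr => m _.
have card_le (A : {set 'I_n}) : (#|A| <= n)%N.
  by rewrite -[X in (_ <= X)%N](card_ord n) max_card.
have mn : (m <= n)%N by rewrite -ltnS.
have subE i j : (n - i = j -> (i <= n)%N -> i = n - j)%N by lia.
rewrite elem_symE mulr_sumr mulr_suml; apply: eq_big => [A|A /eqP mE].
  rewrite -val_eqE /= inordK ?ltnS ?leq_subr//.
  apply/eqP/eqP => [/subE|->]; last by rewrite subKn.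
  by apply; exact: card_le.
have cA : (n - m = #|A|)%N by rewrite -mE inordK ?ltnS ?leq_subr// subKn.
rewrite (bigID (mem A))/= cA.
rewrite (eq_bigr (fun i => - x i)) => [|i ->//].
rewrite [X in _ * X](eq_bigr (fun=> y)) => [|i /negbTE ->//].
rewrite prodrN prodr_const; congr (_ * _ ^+ _).
apply: (@addnI #|A|); transitivity #|'I_n|; first exact: cardC.
by rewrite card_ord -cA subnK.
Qed.

Lemma sum_nat_even (R : realType) (F : nat -> R) (n : nat) :
  (forall m, odd m -> F m = 0) ->
  \sum_(m < n.+1) F m = \sum_(0 <= j < n./2.+1) F (2 * j)%N.
Proof.
move=> F0; elim: n => [|n IH]; first by rewrite big_ord1 big_nat1.
rewrite big_ord_recr/= IH uphalf_half; case: (boolP (odd n)) => n_odd.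
  rewrite add1n (big_nat_recr n./2.+1)//=; congr (_ + F _); lia.
by rewrite F0 ?addr0.
Qed.

Lemma continuous_circ_L0 (R : realType) (k d : nat) :
  continuous (circ_L0 (R := R) k d).
Proof.
apply: continuous_big => [|s _]; first exact: mul_continuous.
move=> y; apply: cvgM; last exact: cvg_cst.
by apply: cvgB; [exact: cvg_id | exact: cvg_cst].
Qed.

Lemma half_mean_cos_series (R : realType) (F : R -> R) (c : nat -> R)
    (d : nat) :
  (0 < d)%N -> (forall t, F t = \sum_(0 <= r < d) c r * cos (r%:R * t)) ->
  half_mean F (c 0).
Proof.
move=> d0 FE.
apply: (half_mean_ext _ _ (@half_mean_sum R nat (index_iota 0 d) xpredT
  (fun r t => c r * cos (r%:R * t)) (fun r => c r * (r == 0)%:R) _))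
  => [t||r _]; first by rewrite FE.
  rewrite big_ltn// mulr1 big_nat big1 ?addr0// => r /andP[r0 _].
  by rewrite gtn_eqF ?mulr0.
apply: half_meanZ; case: r => [|r]; last exact: half_mean_cos.
by apply: half_mean_ext (half_mean1 R) => // t; rewrite mul0r cos0.
Qed.

(** The product is expanded in powers of cos t: odd powers have mean zero, and for m = 2j the sign
    (-1)^(n-2j) is (-1)^n. *)
Lemma half_mean_circ_L0 (R : realType) (k d : nat) : (0 < d)%N ->
  half_mean (fun t => circ_L0 k d (cos t))
    ((-1) ^+ d.-1 / (\prod_(1 <= n < d) (1 - circ_cos R k d n)) *
     \sum_(0 <= j < (d.-1)./2.+1)
       1 / 2 ^+ (2 * j) * 'C(2 * j, j)%:R *
       elem_sym (d.-1 - 2 * j) (fun i : 'I_d.-1 => circ_cos R k d i.+1)).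
Proof.
move=> d0; set n := d.-1.
pose e s := elem_sym s (fun i : 'I_n => circ_cos R k d i.+1).
set p := \prod_(1 <= _ < d) _.
apply: (half_mean_ext _ _ (@half_mean_sum R 'I_n.+1 (index_enum 'I_n.+1) xpredT
  (fun m t => p^-1 * ((-1) ^+ (n - m) * e (n - m)%N) * cos t ^+ m)
  (fun m => p^-1 * ((-1) ^+ (n - m) * e (n - m)%N) *
     (if odd m then 0 else 'C(m, m./2)%:R / 2 ^+ m)) _))
  => [t||m _]; last exact/half_meanZ/half_mean_cos_expr.
  rewrite /circ_L0 prodf_div -/p mulrC big_add1 big_mkord prod_sub_elem_sym.
  by rewrite [RHS]mulr_sumr; apply: eq_bigr => m _; rewrite [RHS]mulrA.
rewrite (sum_nat_even (F := fun m : nat =>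
  p^-1 * ((-1) ^+ (n - m) * e (n - m)%N) *
     (if odd m then 0 else 'C(m, m./2)%:R / 2 ^+ m))) => [|m ->]; last first.
  by rewrite mulr0.
rewrite mulr_sumr big_nat [RHS]big_nat; apply: eq_bigr => j jn.
have jn2 : (2 * j <= n)%N by lia.
have -> : odd (2 * j) = false by lia.
have -> : ((2 * j)./2 = j)%N by lia.
have -> : (-1) ^+ (n - 2 * j) = (-1) ^+ n :> R.
  by rewrite -signr_odd oddB// mul2n odd_double addbF signr_odd.
by rewrite -/(e _); ring.
Qed.

Theorem theorem2 (R : realType) (d k : nat)
    (hd : (2 <= d)%N) (hk : (2 * d <= k)%N) (hkd : coprime k d) :
  let theta := lovasz_theta R (complement_graph (circular_clique k d)) in
  let a : nat -> R := circ_cos R k d in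
  let integral : \bar R :=
    (\int[lebesgue_measure]_(y in `[(-1 : R)%R, 1%R])
      (circ_L0 k d y / Num.sqrt (1 - y ^+ 2)%R)%:E)%E in
  theta%:E = ((k%:R / pi)%:E * integral)%E /\
  ((k%:R / pi)%:E * integral)%E =
    ((-1) ^+ d.-1 * k%:R / (\prod_(1 <= n < d) (1 - a n)) *
     \sum_(0 <= j < (d.-1)./2.+1)
       1 / 2 ^+ (2 * j) * 'C(2 * j, j)%:R *
       elem_sym (d.-1 - 2 * j) (fun i : 'I_d.-1 => a i.+1))%:E.
Proof.
move=> theta a integral.
have d0 : (0 < d)%N by lia.
have [c c_ge0 LE] := circ_L0_cos R d0 hk hkd.
have pi0 : (pi : R) != 0 by rewrite gt_eqF// pi_gt0.
(* Any half mean fixes the integral, so the two expressions for the mean need not be compared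
   directly. *)
have intE m : half_mean (fun t => circ_L0 k d (cos t)) m ->
    ((k%:R / pi)%:E * integral = (k%:R * m)%:E)%E.
  move=> /(half_mean_integral (@continuous_circ_L0 R k d)) I.
  by rewrite /integral I -EFinM; congr EFin; rewrite [m * pi]mulrC mulrA divfK.
split.
  rewrite (intE (c 0)); last exact: half_mean_cos_series d0 LE.
  by rewrite /theta (lovasz_theta_circ d0 hk hkd c_ge0 LE).
rewrite (intE _ (half_mean_circ_L0 R k d0)); congr EFin.
by rewrite /a; ring.
Qed.
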